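(* Let $V$ be a finite set (case $q=1$) or a finite-dimensional $\mathbb{F}_q$-vector space (case $q\ge 2$ a prime power), $n=\operatorname{rk}V$. Let $k\in\{0,\ldots,n\}$, $f:{V\brack k}\to\mathbb{R}$, and $i\in\{\max(\deg(f),0),\ldots,\min(k,n-k)\}$ (so $f\in\bar V_i^{(k)}$). Then $f^\perp\in\bar V_i^{(n-k)}$ and its $i$-weight distribution is given by $$\operatorname{wt}^{(i)}_{f^\perp}(J)=\sum_{I\in{V\brack i}}\gamma(n-k,i,\operatorname{rk}(I^\perp\cap J))\,\operatorname{wt}^{(i)}_f(I)\qquad\text{for all }J\in{V\brack i},$$ where $$\gamma(k,i,z)=\begin{cases}\delta_{z,k}&\text{if }i=k,\\[1mm] (-1)^{i-z}\,\dfrac{1}{q^{(k-i)(i-z)+\binom{i-z}{2}}}\,\dfrac{[k-i]_q}{[k-z]_q}\,\dfrac{1}{{k\brack z}_q}&\text{otherwise,}\end{cases}$$ with $\delta_{z,k}$ the Kronecker delta.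
   Context: For $q=1$, ''subspaces'' of $V$ are subsets and $\operatorname{rk}U=\#U$; for $q\ge2$ they are $\mathbb{F}_q$-linear subspaces and $\operatorname{rk}U=\dim U$. $U\le W$ means inclusion. $\mathcal{L}(V)$ is the lattice of all subspaces of $V$ and ${V\brack k}$ the set of those of rank $k$. $[m]_q=1+q+\cdots+q^{m-1}$ (so $[m]_1=m$), and ${n\brack k}_q$ is the Gaussian binomial coefficient (ordinary binomial for $q=1$). For a subspace $U$ of $V$, $\boldsymbol{x}_U^{(k)}$ is the characteristic function of $\{K\in{V\brack k}\mid U\le K\}$. For $i\in\{0,\ldots,\min(k,n-k)\}$, $\bar V_i^{(k)}\subseteq\mathbb{R}^{{V\brack k}}$ is the real span of $\{\boldsymbol{x}_I^{(k)}\mid I\in{V\brack i}\}$; this set is a basis of $\bar V_i^{(k)}$ (a known fact), and the spaces form an increasing chain with $\bar V^{(k)}_{\min(k,n-k)}=\mathbb{R}^{{V\brack k}}$. For $f\in\bar V_i^{(k)}$, the $i$-weight distribution $\operatorname{wt}_f^{(i)}:{V\brack i}\to\mathbb{R}$ is the unique function with $f=\sum_{I\in{V\brack i}}\operatorname{wt}_f^{(i)}(I)\,\boldsymbol{x}_I^{(k)}$. The degree of a non-zero $f$ is the smallest $t\in\{0,\ldots,\min(k,n-k)\}$ with $f\in\bar V_t^{(k)}$; $\deg(\boldsymbol 0)=-\infty$. Dualization: fix an anti-automorphism (order-reversing bijection) $U\mapsto U^\perp$ of $\mathcal{L}(V)$, e.g. $U\mapsto V\setminus U$ for $q=1$, or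 the orthogonal space with respect to a non-degenerate bilinear form for $q\ge2$. The dualized function of $f:{V\brack k}\to\mathbb{R}$ is $f^\perp:{V\brack n-k}\to\mathbb{R}$ with $f^\perp(K^\perp)=f(K)$ for $K\in{V\brack k}$. *)

(* Defs.v *)
From HB Require Import structures.
From mathcomp Require Import all_boot all_order all_algebra.
From mathcomp Require Import reals.

Set Implicit Arguments.
Unset Strict Implicit.
Unset Printing Implicit Defensive.

Import VectorInternalTheory.
Import Order.TTheory GRing.Theory Num.Theory.
Local Open Scope ring_scope.

(* A vector space over a finite field has finitely many subspaces; the library
   only provides the choiceType structure on {vspace vT}. *)
HB.instance Definition _ (F : finFieldType) (vT : vectType F) :=
  [Countable of {vspace vT} by <:].
HB.instance Definition _ (F : finFieldType) (vT : vectType F) :=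
  [Finite of {vspace vT} by <:].

(* The ambient space: a finite set (q = 1), or a finite-dimensional vector
   space over the field with q >= 2 elements. *)
Inductive qspace : Type :=
  | QSet (T : finType)
  | QVect (F : finFieldType) (vT : vectType F).

Definition qorder (V : qspace) : nat :=
  match V with QSet _ => 1 | QVect F _ => #|F| end.

Definition subsp (V : qspace) : finType :=
  match V with QSet T => {set T} | QVect F vT => {vspace vT} end.

Definition suble (V : qspace) : rel (subsp V) :=
  match V return rel (subsp V) with
  | QSet T => fun U W : {set T} => U \subset W
  | QVect F vT => fun U W : {vspace vT} => (U <= W)%VS
  end.

Definition subcap (V : qspace) : subsp V -> subsp V -> subsp V :=
  match V return subsp V -> subsp V -> subsp V with
  | QSet T => fun U W : {set T} => U :&: W
  | QVect F vT => fun U W : {vspace vT} => (U :&: W)%VS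
  end.

Definition subtop (V : qspace) : subsp V :=
  match V return subsp V with
  | QSet T => [set: T]
  | QVect F vT => fullv
  end.

Definition rk (V : qspace) : subsp V -> nat :=
  match V return subsp V -> nat with
  | QSet T => fun U : {set T} => #|U|
  | QVect F vT => fun U : {vspace vT} => \dim U
  end.

Definition rkV (V : qspace) : nat := rk (subtop V).

Definition grass (V : qspace) (k : nat) : Type := {U : subsp V | rk U == k}.

Definition qint (q m : nat) : nat := (\sum_(j < m) q ^ j)%N.

(* Gaussian binomial; for q = 1 it is the ordinary binomial coefficient. *)
Definition qbin (R : realType) (q m z : nat) : R :=
  \prod_(j < z) ((qint q (m - j))%:R / (qint q j.+1)%:R).

Section Functions.
Variables (R : realType) (V : qspace).

(* R^o rather than R, so that the functions form a vector space over R. *)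
Definition kfun (k : nat) := {ffun grass V k -> R^o}.

Definition xfun (k : nat) (U : subsp V) : kfun k :=
  [ffun K : grass V k => (suble U (val K))%:R].

Definition xfuns (k i : nat) : #|{: grass V i}|.-tuple (kfun k) :=
  [tuple xfun k (val (enum_val j)) | j < #|{: grass V i}|].

Definition Vbar (k i : nat) : {vspace kfun k} := <<xfuns k i>>%VS.

(* The coordinates of f on the generators xfun k I. For i <= minn k (n - k)
   these generators are a basis of Vbar k i, so wt is then the unique family
   of coefficients decomposing f (see wt_sum). *)
Definition wt (k i : nat) (f : kfun k) (I : grass V i) : R :=
  coord (xfuns k i) (enum_rank I) f.

Lemma wt_sum (k i : nat) (f : kfun k) :
  f \in Vbar k i -> f = \sum_(I : grass V i) wt f I *: xfun k (val I).
Proof.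
move=> fV; rewrite {1}(coord_span fV).
rewrite (reindex (@enum_rank (grass V i))) /=.
  by apply: eq_bigr => I _; rewrite nth_mktuple enum_rankK.
by apply: onW_bij; apply: enum_rank_bij.
Qed.

(* None stands for -oo. As Vbar k (minn k (n - k)) is the full space, find
   always succeeds on a non-zero f. *)
Definition degree (k : nat) (f : kfun k) : option nat :=
  if f == 0 then None
  else Some (find (fun t => f \in Vbar k t)
                  (iota 0 (minn k (rkV V - k)).+1)).

Definition antiauto (perp : subsp V -> subsp V) : Prop :=
  bijective perp /\ forall U W, suble U W = suble (perp W) (perp U).

(* perp maps rank k onto rank n - k, so the default value 0 is never taken
   when perp is an anti-automorphism and k <= n. *)
Definition dualfun (perp : subsp V -> subsp V) (k : nat) (f : kfun k) :
    kfun (rkV V - k) :=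
  [ffun K' => if [pick K : grass V k | perp (val K) == val K'] is Some K
              then f K else 0].

Lemma dualfunE (perp : subsp V -> subsp V) (k : nat) (f : kfun k)
    (K : grass V k) (K' : grass V (rkV V - k)) :
  antiauto perp -> val K' = perp (val K) -> dualfun perp f K' = f K.
Proof.
move=> [/bij_inj inj_p _] eK; rewrite ffunE eK.
case: pickP => [K1 /eqP/inj_p/val_inj-> // | /(_ K)].
by rewrite eqxx.
Qed.

End Functions.

(* The subtractions are only used for z <= i <= k. *)
Definition gamma (R : realType) (q k i z : nat) : R :=
  if i == k then (z == k)%:R
  else (-1) ^+ (i - z)
       * (1 / q%:R ^+ ((k - i) * (i - z) + 'C(i - z, 2)))
       * ((qint q (k - i))%:R / (qint q (k - z))%:R)
       * (1 / qbin R q k z).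

(* Main.v *)
(** Both functions are expanded in characteristic functions: f^perp is the
    combination, with the weights of f, of the indicators of {K | K <= I^perp}.
    So the formula reduces to the identity, for rk K = k and rk U = n - i,
      sum_(J <= K, rk J = i) gamma(k, i, rk (U cap J)) = [K <= U].
    If K is not below U, choose a hyperplane H of K above U cap K.  A J not
    below H is determined up to q^(k-i) choices by its trace J cap H, which has
    rank i - 1 and meets U as J does; counting the flags I < J <= H twice turns
    the sum into one over J <= H only, and its terms vanish one by one because
      q^(k-z) [z] gamma(k, i, z-1) = - [k-z] gamma(k, i, z)   (z > 0).
    The same identity, read through perp with k = n - i, inverts the incidence
    matrix between ranks i and n - i, which yields the independence of the
    x_I and hence the uniqueness of the weights. *)

Require Import Defs.
From mathcomp Require Import all_boot all_order all_algebra.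
From mathcomp Require Import finfield.
From mathcomp Require Import reals.
From mathcomp Require Import zify ring.

Import Order.TTheory GRing.Theory Num.Theory.
Local Open Scope ring_scope.

(** * Arithmetic of q-integers *)

Lemma qintD (q a b : nat) : (qint q (a + b) = qint q a + q ^ a * qint q b)%N.
Proof.
rewrite /qint big_split_ord /= big_distrr /=.
by congr (_ + _)%N; apply: eq_bigr => j _; rewrite expnD.
Qed.

Lemma qint_gt0 (q m : nat) : (0 < m)%N -> (0 < qint q m)%N.
Proof. by case: m => // m _; rewrite /qint big_ord_recl expn0. Qed.

Lemma qint1 (q : nat) : qint q 1 = 1%N.
Proof. by rewrite /qint big_ord1. Qed.

Lemma qint_base1 (m : nat) : qint 1 m = m.
Proof. by rewrite /qint (eq_bigr (fun=> 1%N)) ?sum1_card ?card_ord // => j _; rewrite exp1n. Qed.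

Lemma expn_qint (q m : nat) : (0 < q -> q ^ m = (q - 1) * qint q m + 1)%N.
Proof.
move=> q0; elim: m => [|m IH]; first by rewrite /qint big_ord0 muln0.
by rewrite -addn1 qintD qint1 muln1 expnD expn1 IH; nia.
Qed.

(** * The subspace lattice, uniformly for sets and vector spaces *)

Lemma card_finvect_vspace (F : finFieldType) (vT : vectType F) (W : {vspace vT}) :
  #|[pred v : finvect_type vT | v \in W]| = (#|F| ^ \dim W)%N.
Proof.
(* Only for a constructor-headed vT are the vector structures of vT and
   finvect_type vT convertible. *)
case: vT W => T c W.
rewrite -(@card_vspace F (finvect_type (Vector.Pack c) : finType) c W).
by apply: eq_card => v; rewrite inE.
Qed.

Section Subspaces.
Variable V : qspace.
Implicit Types A B C U W J K : subsp V.

Lemma qorder_gt0 : (0 < qorder V)%N.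
Proof. by case: V => //= F _; apply/card_gt0P; exists 0. Qed.

Lemma suble_refl A : suble A A.
Proof. by case: V A => [T|F vT] A /=; [exact: subxx | exact: subvv]. Qed.

Lemma suble_trans A B C : suble A B -> suble B C -> suble A C.
Proof. by case: V A B C => [T|F vT] A B C /=; [exact: subset_trans | exact: subv_trans]. Qed.

Lemma suble_cap A B C : suble A (subcap B C) = suble A B && suble A C.
Proof. by case: V A B C => [T|F vT] A B C /=; [exact: subsetI | exact: subv_cap]. Qed.

Lemma suble_top A : suble A (subtop V).
Proof. by case: V A => [T|F vT] A /=; [exact: subsetT | exact: subvf]. Qed.

Lemma rk_suble A B : suble A B -> (rk A <= rk B)%N.
Proof. by case: V A B => [T|F vT] A B /=; [exact: subset_leq_card | exact: dimvS]. Qed.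

Lemma suble_rk_eq A B : suble A B -> (rk B <= rk A)%N -> A = B.
Proof.
case: V A B => [T|F vT] A B /= sAB lBA; apply/eqP.
  by rewrite eqEcard sAB.
by rewrite eqEdim sAB.
Qed.

Lemma rk0_suble A B : rk A = 0%N -> suble A B.
Proof.
case: V A B => [T|F vT] A B /= /eqP.
  by rewrite cards_eq0 => /eqP ->; rewrite sub0set.
by rewrite dimv_eq0 => /eqP ->; rewrite sub0v.
Qed.

Lemma rk0_ex : exists A, rk A = 0%N.
Proof.
by case: V => [T|F vT] /=; [exists set0; rewrite cards0 | exists 0%VS; rewrite dimv0].
Qed.

Lemma rk_cap A B C : suble A C -> suble B C ->
  (rk A + rk B <= rk C + rk (subcap A B))%N.
Proof.
case: V A B C => [T|F vT] A B C /= sAC sBC.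
  rewrite -cardsUI leq_add2r; apply: subset_leq_card.
  by rewrite subUset sAC.
by rewrite -dimv_sum_cap leq_add2r; apply: dimvS; rewrite subv_add sAC.
Qed.

(** For sets, the atoms over A are the [x |: A] with x in [B :\: A]. For vector spaces, v -> A + <v>
    maps the vectors of B outside A onto the atoms; the fibre of J is J minus A, of size q^(a+1) -
    q^a with a = [\dim A]. *)
Lemma card_atoms A B : suble A B ->
  #|[pred J | [&& suble A J, suble J B & rk J == (rk A).+1]]|
    = qint (qorder V) (rk B - rk A).
Proof.
case: V A B => [T|F vT] A B /= sAB.
  rewrite qint_base1 -cardsDS //.
  rewrite -(@card_in_imset _ _ (fun x => x |: A) (B :\: A)); last first.
    move=> x y; rewrite !inE => /andP[xA _] /andP[yA _] /setP/(_ x).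
    by rewrite !inE eqxx (negbTE xA) !orbF => /esym/eqP.
  apply: eq_card => J; rewrite inE /=; apply/and3P/imsetP.
    move=> [sAJ sJB /eqP cJ].
    have /cards1P[x xE] : #|J :\: A| == 1%N by rewrite cardsDS // cJ subSnn.
    have : x \in J :\: A by rewrite xE set11.
    rewrite inE => /andP[xA xJ]; exists x; first by rewrite inE xA (subsetP sJB).
    apply/setP => y; rewrite 2!inE; have /setP/(_ y) := xE.
    by rewrite !inE => <-; have /implyP := subsetP sAJ y; case: (y \in A); case: (y \in J).
  move=> [x]; rewrite inE => /andP[xA xB] ->.
  by rewrite subsetUr subUset sub1set xB sAB cardsU1 xA.
pose N := #|[pred J : {vspace vT} | [&& (A <= J)%VS, (J <= B)%VS & \dim J == (\dim A).+1]]|.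
change (N = qint #|F| (\dim B - \dim A)).
have F1 : (1 < #|F|)%N by exact: finRing_gt1.
(* The same vectors with a finite type structure, so that they can be counted. *)
pose w := finvect_type vT.
have cardw (W : {vspace vT}) : #|[pred v : w | v \in W]| = (#|F| ^ \dim W)%N.
  exact: card_finvect_vspace.
have cD (W1 W2 : {vspace vT}) : (W1 <= W2)%VS ->
    #|[pred v : w | (v \in W2) && (v \notin W1)]| = (#|F| ^ \dim W2 - #|F| ^ \dim W1)%N.
  move=> s12; rewrite -(cardw W1) -(cardw W2).
  rewrite -(cardID [pred v : w | v \in W1] [pred v : w | v \in W2]).
  rewrite (@eq_card w [predI _ & _] [pred v : w | v \in W1]).
    by rewrite addKn; apply: eq_card => v; rewrite !inE andbC.
  move=> v; rewrite !inE.
  by have /implyP := subvP s12 v; case: (v \in W1); rewrite ?andbT ?andbF.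
have memA1 (v : vT) : v \in (A + <[v]>)%VS by rewrite memvE addvSr.
have dimA1 (J : {vspace vT}) (v : w) : (A <= J)%VS -> v \in J -> v \notin A ->
    (A + <[v : vT]> <= J)%VS /\ \dim (A + <[v : vT]>) = (\dim A).+1.
  move=> sAJ vJ vA; split; first by rewrite subv_add sAJ -memvE.
  apply/eqP; rewrite eqn_leq; apply/andP; split.
    have := dimv_sum_cap A <[v : vT]>; rewrite dim_vline.
    by case: (_ != _); lia.
  rewrite ltnNge; apply: contra vA => le.
  have <- : (A + <[v : vT]>)%VS = A by apply/esym/eqP; rewrite eqEdim addvSl.
  exact: memA1.
have: (N * (#|F| ^ (\dim A).+1 - #|F| ^ \dim A) = #|F| ^ \dim B - #|F| ^ \dim A)%N.
  rewrite -(cD _ _ sAB) -[RHS]sum1_card.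
  rewrite (partition_big (fun v : w => (A + <[v : vT]>)%VS)
     [pred J : {vspace vT} | [&& (A <= J)%VS, (J <= B)%VS & \dim J == (\dim A).+1]]) /=; last first.
    move=> v; rewrite inE => /andP[vB vA].
    by have [-> ->] := dimA1 B v sAB vB vA; rewrite addvSl eqxx.
  rewrite /N -[X in (X * _)%N]sum1_card big_distrl /=; apply: eq_bigr => J /and3P[sAJ sJB /eqP dJ].
  rewrite mul1n -dJ -(cD _ _ sAJ) sum1_card; apply: eq_card => v; rewrite !inE.
  apply/andP/andP => [[vJ vA]|[/andP[vB vA] /eqP <-]].
    have [sJ dv] := dimA1 J v sAJ vJ vA; have vB : v \in B := subvP sJB _ vJ.
    split; first by apply/andP; split; [exact: vB | exact: vA].
    by rewrite eqEdim sJ dv dJ leqnn.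
  by split => //; exact: memA1.
have qA : (0 < #|F| ^ \dim A)%N by rewrite expn_gt0 ltnW.
have -> : (#|F| ^ \dim B)%N
    = (#|F| ^ \dim A * ((#|F| - 1) * qint #|F| (\dim B - \dim A) + 1))%N.
  by rewrite -expn_qint 1?ltnW // -expnD subnKC ?dimvS.
rewrite expnS => E.
have arith (a b c : nat) : (0 < a -> 1 < c ->
    N * (c * a - a) = a * ((c - 1) * b + 1) - a -> N = b)%N.
  move=> a0 c1 e; have {}e : (N * (a * (c - 1)) = b * (a * (c - 1)))%N by nia.
  by apply/eqP; rewrite -(@eqn_pmul2r (a * (c - 1))) ?e ?muln_gt0 ?a0 ?subn_gt0.
exact: arith qA F1 E.
Qed.
End Subspaces.

(** * The recursion of [gamma] in its last argument *)

Section Gamma.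
Variables (R : realType) (q : nat).
Hypothesis q_gt0 : (0 < q)%N.

Lemma qintR_neq0 (m : nat) : (0 < m)%N -> (qint q m)%:R != 0 :> R.
Proof. by move=> m0; rewrite pnatr_eq0 -lt0n qint_gt0. Qed.

Lemma qbinS (m z : nat) :
  qbin R q m z.+1 = qbin R q m z * ((qint q (m - z))%:R / (qint q z.+1)%:R).
Proof. by rewrite /qbin big_ord_recr. Qed.

Lemma qbin_neq0 (m z : nat) : (z <= m)%N -> qbin R q m z != 0.
Proof.
move=> zm; apply/prodf_neq0 => j _; have jz := ltn_ord j.
by rewrite mulf_neq0 ?invr_eq0 ?qintR_neq0 //; lia.
Qed.

(** From z to z+1 the exponent of q drops by (k-i) + (i-z-1) = k-z-1, and the Gaussian binomial
    grows by the factor [k-z]/[z+1], whose numerator cancels the [k-z] of [gamma]. *)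
Lemma gamma_rec (k i z : nat) : (i < k)%N -> (z < i)%N ->
  q%:R ^+ (k - z.+1) * (qint q z.+1)%:R * gamma R q k i z
    = - (qint q (k - z.+1))%:R * gamma R q k i z.+1.
Proof.
move=> ik zi; rewrite /gamma ltn_eqF //.
have [s es] : exists s, (i - z = s.+1)%N by exists (i - z.+1)%N; lia.
have es1 : (i - z.+1 = s)%N by lia.
have ek : (k - z.+1 = k - i + s)%N by lia.
have q0 : q%:R != 0 :> R by rewrite pnatr_eq0 -lt0n.
have n1 : (qint q (k - z))%:R != 0 :> R by apply: qintR_neq0; lia.
have n2 : (qint q (k - i + s))%:R != 0 :> R by apply: qintR_neq0; lia.
have n3 : (qint q z.+1)%:R != 0 :> R by apply: qintR_neq0.
have n4 : qbin R q k z != 0 by apply: qbin_neq0; lia.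
rewrite es es1 ek qbinS binS bin1 mulnS.
rewrite (_ : k - i + (k - i) * s + ('C(s, 2) + s)
  = (k - i + s) + ((k - i) * s + 'C(s, 2)))%N; last by lia.
rewrite !(exprD _ _ ((k - i) * s + _)) exprS.
set a := q%:R ^+ (k - i + s); set b := q%:R ^+ (_ + 'C(s, 2)).
have a0 : a != 0 by rewrite expf_neq0.
have b0 : b != 0 by rewrite expf_neq0.
by field; rewrite a0 b0 n1 n2 n3 n4.
Qed.

End Gamma.

(** * Anti-automorphisms: ranks and coatoms *)

Section Anti.
Variables (V : qspace) (perp : subsp V -> subsp V).
Hypothesis antiP : antiauto perp.
Implicit Types A B C U W J K : subsp V.
Let perp_inj : injective perp := bij_inj antiP.1.
Let perpS := antiP.2.

(** [antiauto] does not mention ranks. They are controlled by climbing from A to B one atom at a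
    time: each step strictly lowers the rank of the image, by injectivity. *)
Lemma rk_perp_suble A B : suble A B ->
  (rk (perp B) + (rk B - rk A) <= rk (perp A))%N.
Proof.
move: {2}(rk B - rk A)%N (erefl (rk B - rk A)%N) => m.
elim: m A => [|m IH] A em sAB.
  by rewrite em addn0; apply: rk_suble; rewrite -perpS.
have /card_gt0P[A'] : (0 < #|[pred J | [&& suble A J, suble J B & rk J == (rk A).+1]]|)%N.
  by rewrite card_atoms // qint_gt0 // em.
rewrite inE => /and3P[sAA' sA'B /eqP rA'].
have l1 : (rk (perp B) + (rk B - rk A') <= rk (perp A'))%N by apply: IH => //; lia.
have s1 : suble (perp A') (perp A) by rewrite -perpS.
have l2 : (rk (perp A') < rk (perp A))%N.
  rewrite ltnNge; apply/negP => /(suble_rk_eq _ _ _ s1) /perp_inj eA.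
  by move: rA'; rewrite eA; lia.
lia.
Qed.

(** The chain bound from rank 0 up to A gives one inequality, the bound from A up to the whole space
    the other. *)
Lemma rk_perp A : rk (perp A) = (rkV V - rk A)%N.
Proof.
have [B B0] := rk0_ex V.
have := rk_perp_suble _ _ (suble_top _ A); have := rk_perp_suble _ _ (rk0_suble _ B A B0).
by have := rk_suble _ _ _ (suble_top _ (perp B)); rewrite -/(rkV V) B0 /rkV; lia.
Qed.

(** [perp] carries the coatoms between A and B to the atoms between [perp B] and [perp A]. *)
Lemma card_coatoms A B : suble A B ->
  #|[pred J | [&& suble A J, suble J B & (rk J).+1 == rk B]]|
    = qint (qorder V) (rk B - rk A).
Proof.
move=> sAB; have s1 : suble (perp B) (perp A) by rewrite -perpS.
have rV C : (rk C <= rkV V)%N := rk_suble _ _ _ (suble_top _ C).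
have -> : (rk B - rk A = rk (perp A) - rk (perp B))%N.
  by rewrite !rk_perp; have := rV A; have := rV B; lia.
rewrite -card_atoms // -[RHS]cardsE -(card_preimset _ perp_inj).
apply: eq_card => J; rewrite !inE -!perpS andbCA; congr [&& _, _ & _].
by rewrite !rk_perp; have := rV J; have := rV B; lia.
Qed.
End Anti.

(** * Double counting of flags *)

Section Counting.
Variables (R : realType) (V : qspace) (perp : subsp V -> subsp V).
Hypothesis antiP : antiauto perp.
Implicit Types A B C U W I J K L : subsp V.
Local Notation q := (qorder V).
Local Notation qn m := ((qint q m)%:R : R).

Lemma sum_flags (K : subsp V) (t : nat) (g : subsp V -> R) :
  \sum_(J | suble J K && (rk J == t.+1)) \sum_(I | suble I J && (rk I == t)) g I
    = qn (rk K - t) * \sum_(I | suble I K && (rk I == t)) g I.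
Proof.
rewrite (exchange_big_dep (fun I => suble I K && (rk I == t))) /=; last first.
  by move=> J I /andP[sJK _] /andP[sIJ ->]; rewrite (suble_trans _ _ _ _ sIJ).
rewrite big_distrr /=; apply: eq_bigr => I /andP[sIK /eqP rI].
rewrite -rI -(card_atoms _ _ _ sIK) sumr_const -[LHS]mulr_natl; congr (_%:R * _).
apply: eq_card => J; rewrite !inE [LHS]unfold_in rI eqxx andbT.
by case: (suble J K); rewrite /= ?andbF // andbC.
Qed.

Lemma sum_flags_coatoms (L : subsp V) (i k : nat) (g : subsp V -> R) : rk L = k.+1 ->
  \sum_(K | suble K L && (rk K == k)) \sum_(I | suble I K && (rk I == i)) g I
    = qn (k.+1 - i) * \sum_(I | suble I L && (rk I == i)) g I.
Proof.
move=> rL.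
rewrite (exchange_big_dep (fun I => suble I L && (rk I == i))) /=; last first.
  by move=> J I /andP[sJK _] /andP[sIJ ->]; rewrite (suble_trans _ _ _ _ sIJ).
rewrite big_distrr /=; apply: eq_bigr => I /andP[sIL /eqP rI].
rewrite -rI -rL -(card_coatoms _ _ antiP _ _ sIL) sumr_const -[LHS]mulr_natl; congr (_%:R * _).
apply: eq_card => J; rewrite !inE [LHS]unfold_in rI rL eqSS eqxx andbT.
by case: (suble J L); rewrite /= ?andbF // andbC.
Qed.

(** Induction by [sum_flags] with g = 1: each J of rank t+1 has [t+1] hyperplanes, so consecutive
    counts have ratio [rk K - t]/[t+1]. *)
Lemma card_subsp_rk (K : subsp V) (i : nat) : (i <= rk K)%N ->
  \sum_(J | suble J K && (rk J == i)) (1 : R) = qbin R q (rk K) i.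
Proof.
elim: i => [|t IH] tK.
  have [B B0] := rk0_ex V.
  rewrite /qbin big_ord0 (bigD1 B) /=; last by rewrite rk0_suble // B0.
  rewrite big1 ?addr0 // => J /andP[/andP[_ /eqP J0] /eqP[]].
  by apply: suble_rk_eq; rewrite ?rk0_suble ?J0 ?B0.
have h : qn t.+1 != 0 by apply: qintR_neq0 => //; apply: qorder_gt0.
apply: (mulfI h); rewrite qbinS -IH ?(ltnW tK) // [RHS]mulrCA [X in _ = _ * X]mulrC divfK //.
rewrite [RHS]mulrC -sum_flags big_distrr /=; apply: eq_bigr => J /andP[_ /eqP rJ].
have [B B0] := rk0_ex V; have sBJ := rk0_suble _ B J B0.
have := card_coatoms _ _ antiP _ _ sBJ; rewrite B0 subn0 rJ => <-.
rewrite mulr1 -sumr_const; apply: eq_bigl => I; rewrite !inE eqSS.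
by rewrite rk0_suble.
Qed.
End Counting.

(** * The [gamma] identity for a fixed pair U, K *)

Section Incidence.
Variables (R : realType) (V : qspace) (perp : subsp V -> subsp V).
Hypothesis antiP : antiauto perp.
Implicit Types A B C U W H I J K L : subsp V.
Local Notation q := (qorder V).
Local Notation qn m := ((qint q m)%:R : R).

Lemma suble_capl A B : suble (subcap A B) A.
Proof. by have := suble_refl _ (subcap A B); rewrite suble_cap => /andP[]. Qed.

Lemma suble_capr A B : suble (subcap A B) B.
Proof. by have := suble_refl _ (subcap A B); rewrite suble_cap => /andP[]. Qed.

Lemma suble_anti A B : suble A B -> suble B A -> A = B.
Proof. by move=> sAB sBA; apply: suble_rk_eq => //; apply: rk_suble. Qed.

(** A hyperplane I of J meets U in rank z if it contains U cap J, and in rank z-1 otherwise. The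
    right side gives every I the value at z-1, then corrects the [t+1-z] hyperplanes of the first
    kind. For z = 0 the correction vanishes, as [z.-1] is 0 too. *)
Lemma sum_hyperplanes_cap U J (t : nat) (g : nat -> R) : rk J = t.+1 ->
  let z := rk (subcap U J) in
  \sum_(I | suble I J && (rk I == t)) g (rk (subcap U I))
    = qn t.+1 * g z.-1 + qn (t.+1 - z) * (g z - g z.-1).
Proof.
move=> rJ z.
have [B B0] := rk0_ex V.
have -> : qn t.+1 * g z.-1 = \sum_(I | suble I J && (rk I == t)) g z.-1.
  have := card_coatoms _ _ antiP _ _ (rk0_suble _ B J B0); rewrite B0 subn0 rJ => <-.
  rewrite mulr_natl -sumr_const; apply: eq_bigl => I; rewrite !inE eqSS.
  by rewrite rk0_suble.
have -> : qn (t.+1 - z) * (g z - g z.-1) =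
    \sum_(I | suble I J && (rk I == t)) (if suble (subcap U J) I then g z - g z.-1 else 0).
  rewrite -big_mkcondr /= -rJ -(card_coatoms _ _ antiP _ _ (suble_capr U J)).
  rewrite mulr_natl -sumr_const; apply: eq_bigl => I; rewrite !inE rJ eqSS.
  by rewrite andbC.
rewrite -big_split /=; apply: eq_bigr => I /andP[sIJ /eqP rI].
have sIU : suble (subcap U I) (subcap U J).
  by rewrite suble_cap suble_capl (suble_trans _ _ _ _ (suble_capr U I)).
case: ifP => [s|/negbT ns].
  rewrite addrC subrK; congr (g _); congr (rk _); apply: suble_anti => //.
  by rewrite suble_cap suble_capl s.
rewrite addr0; congr (g _).
have l1 : (rk (subcap U I) < z)%N.
  rewrite ltnNge; apply/negP => /(suble_rk_eq _ _ _ sIU) e.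
  by move: ns; rewrite -e suble_capr.
have := rk_cap _ _ _ _ (suble_capr U J) sIJ.
have : (rk (subcap (subcap U J) I) <= rk (subcap U I))%N.
  apply: rk_suble; rewrite suble_cap suble_capr andbT.
  by rewrite (suble_trans _ _ _ _ (suble_capl _ _)) ?suble_capl.
rewrite -/z rJ rI; lia.
Qed.

(** Here U cap J = J, so for i < rk K every term is the inverse of the number of terms. *)
Lemma sum_gamma_sub U K (i : nat) : (i <= rk K)%N -> suble K U ->
  \sum_(J | suble J K && (rk J == i)) gamma R q (rk K) i (rk (subcap U J)) = 1.
Proof.
move=> ik sKU.
have [eik|nik] := eqVneq i (rk K).
  rewrite (bigD1 K) /=; last by rewrite suble_refl eik eqxx.
  rewrite big1 ?addr0 => [|J /andP[/andP[sJK /eqP rJ] /eqP[]]]; last first.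
    by apply: suble_rk_eq => //; rewrite rJ eik.
  have -> : subcap U K = K.
    by apply: suble_anti; rewrite ?suble_capr // suble_cap sKU suble_refl.
  by rewrite /gamma eik !eqxx.
rewrite (eq_bigr (fun=> 1 / qbin R q (rk K) i * 1)) => [|J /andP[sJK /eqP rJ]].
  rewrite -big_distrr /= (card_subsp_rk _ _ _ antiP) //.
  by rewrite mul1r mulVf // qbin_neq0 // qorder_gt0.
have -> : subcap U J = J.
  apply: suble_anti; rewrite ?suble_capr // suble_cap suble_refl.
  by rewrite (suble_trans _ _ _ _ sJK).
rewrite rJ /gamma (negbTE nik) subnn muln0 bin0n !expr0 divff ?oner_eq0 //.
rewrite divff ?mul1r ?mulr1 // qintR_neq0 ?qorder_gt0 //; lia.
Qed.

(** U cap J lies in U cap K, hence in H, so U meets J and its trace I = J cap H alike. Counting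
    atoms over I in K and in H, the J not below H with trace I number [rk K - i] - [rk H - i] =
    q^(rk H - i). *)
Lemma sum_cap_split U K H (i : nat) (g : nat -> R) :
  suble H K -> (rk H).+1 = rk K -> suble (subcap U K) H -> (i.+1 < rk K)%N ->
  \sum_(J | suble J K && (rk J == i.+1)) g (rk (subcap U J))
    = \sum_(J | suble J H && (rk J == i.+1)) g (rk (subcap U J))
      + q%:R ^+ (rk K - i.+1)
        * \sum_(I | suble I H && (rk I == i)) g (rk (subcap U I)).
Proof.
move=> sHK rH sUH ik.
rewrite (bigID (fun J => suble J H)) /=; congr (_ + _).
  apply: eq_bigl => J; case sJH : (suble J H); rewrite ?andbF ?andbT //=.
  by rewrite (suble_trans _ _ _ _ sJH).
have rJH J : suble J K -> rk J = i.+1 -> ~~ suble J H -> rk (subcap J H) = i.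
  move=> sJK rJ nJH; have := rk_cap _ _ _ _ sJK sHK.
  have : (rk (subcap J H) < rk J)%N.
    rewrite ltnNge; apply: contra nJH => /(suble_rk_eq _ _ _ (suble_capl J H)) <-.
    exact: suble_capr.
  lia.
rewrite (partition_big (fun J => subcap J H) (fun I => suble I H && (rk I == i))) /=; last first.
  by move=> J /andP[/andP[sJK /eqP rJ] nJH]; rewrite suble_capr rJH ?eqxx.
rewrite big_distrr /=; apply: eq_bigr => I /andP[sIH /eqP rI].
have sIK := suble_trans _ _ _ _ sIH sHK.
rewrite (eq_bigl (fun J => [&& suble I J, suble J K & rk J == (rk I).+1] && ~~ suble J H)); last first.
  move=> J; rewrite rI; case sJK : (suble J K); rewrite ?andbF //=.
  case: eqP => rJ; rewrite ?andbF //= andbT.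
  case sJH : (suble J H); rewrite ?andbF //= andbT.
  apply/eqP/idP => [<-|sIJ]; first exact: suble_capl.
  apply/esym/suble_rk_eq; first by rewrite suble_cap sIJ.
  by rewrite rJH ?sJH // rI.
rewrite (eq_bigr (fun=> g (rk (subcap U I)))); last first.
  move=> J /andP[/and3P[sIJ sJK /eqP rJ] nJH]; congr (g (rk _)); apply: suble_anti.
    rewrite suble_cap suble_capl /=.
    have -> : I = subcap J H.
      by apply: suble_rk_eq; [rewrite suble_cap sIJ | rewrite rJH ?rJ ?rI].
    rewrite suble_cap suble_capr (suble_trans _ _ _ _ _ sUH) //.
    by rewrite suble_cap suble_capl (suble_trans _ _ _ _ (suble_capr U J)).
  by rewrite suble_cap suble_capl (suble_trans _ _ _ _ (suble_capr U I)).
rewrite sumr_const -[LHS]mulr_natl; congr (_ * _).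
set P := [pred J | [&& suble I J, suble J K & rk J == (rk I).+1]].
have := cardID [pred J | suble J H] P; rewrite card_atoms // rI.
have -> : #|[predI P & [pred J | suble J H]]| = qint q (rk H - i).
  rewrite -rI -card_atoms //; apply: eq_card => J; rewrite !inE.
  case sJH : (suble J H); rewrite ?andbF //= andbT.
  by rewrite (suble_trans _ _ _ _ sJH).
have -> : (rk K - i = rk H - i + 1)%N by lia.
rewrite qintD qint1 muln1 => /addnI eP.
have -> : (rk K - i.+1 = rk H - i)%N by lia.
rewrite -natrX -eP; congr (_%:R); apply: eq_card => J; rewrite !inE.
by rewrite [LHS]unfold_in rI andbC.
Qed.

Lemma sum_gamma_nsub U K (i : nat) : rk U = (rkV V - i)%N -> (i <= rkV V)%N ->
  (i < rk K)%N -> ~~ suble K U ->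
  \sum_(J | suble J K && (rk J == i)) gamma R q (rk K) i (rk (subcap U J)) = 0.
Proof.
move=> rU iV ik nKU.
have {nKU}lUK : (rk (subcap U K) < rk K)%N.
  rewrite ltnNge; apply: contra nKU => /(suble_rk_eq _ _ _ (suble_capr U K)) <-.
  exact: suble_capl.
(* For i = 0, U is the whole space, against [lUK]. *)
case: i rU iV ik => [|i] rU iV ik.
  have := rk_cap _ _ _ _ (suble_top _ U) (suble_top _ K).
  by rewrite rU -/(rkV V); lia.
have /card_gt0P[H] : (0 < #|[pred J | [&& suble (subcap U K) J, suble J K & (rk J).+1 == rk K]]|)%N.
  by rewrite (card_coatoms _ _ antiP) ?suble_capr // qint_gt0 // subn_gt0.
rewrite inE => /and3P[sUH sHK /eqP rH].
rewrite (sum_cap_split U K H) //.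
have rHi : (rk H - i = rk K - i.+1)%N by lia.
have n0 : qn (rk H - i) != 0.
  by apply: qintR_neq0; lia.
(* The factor [rk H - i] turns the sum over I into one over flags I < J below H, so both sums range
   over the same J. *)
apply: (mulfI n0); rewrite mulr0 mulrDr mulrCA -sum_flags !big_distrr /= -big_split /=.
apply: big1 => J /andP[sJH /eqP rJ]; rewrite (sum_hyperplanes_cap U J i _ rJ).
set z := rk (subcap U J); set g := gamma R q (rk K) i.+1.
have sJK := suble_trans _ _ _ _ sJH sHK.
have zi : (z <= i.+1)%N by rewrite -rJ; apply: rk_suble; apply: suble_capr.
(* U cap K has rank at least rk K - (i+1) and J has rank i+1; both lie in H, of rank rk K - 1, so
   they meet. *)
have z0 : (0 < z)%N.
  have := rk_cap _ _ _ _ (suble_top _ U) (suble_top _ K).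
  have := rk_cap _ _ _ _ sUH sJH.
  have : (rk (subcap (subcap U K) J) <= z)%N.
    apply: rk_suble; rewrite suble_cap suble_capr andbT.
    by rewrite (suble_trans _ _ _ _ (suble_capl _ _)) ?suble_capl.
  by rewrite rU -/(rkV V) rJ; lia.
have gr : q%:R ^+ (rk K - z) * qn z * g z.-1 = - qn (rk K - z) * g z.
  have := gamma_rec R q (qorder_gt0 _) (rk K) i.+1 z.-1 ik.
  by rewrite prednK //; apply.
have e1 : qn (rk K - z) = qn (rk K - i.+1) + q%:R ^+ (rk K - i.+1) * qn (i.+1 - z).
  by rewrite -natrX -natrM -natrD -qintD; congr (qint _ _)%:R; lia.
have e2 : qn i.+1 = qn (i.+1 - z) + q%:R ^+ (i.+1 - z) * qn z.
  by rewrite -natrX -natrM -natrD -qintD; congr (qint _ _)%:R; lia.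
have e3 : q%:R ^+ (rk K - z) = q%:R ^+ (rk K - i.+1) * q%:R ^+ (i.+1 - z) :> R.
  by rewrite -exprD; congr (_ ^+ _); lia.
rewrite rHi e2; move: gr; rewrite e3 e1 => gr.
(* The coefficient of g z becomes [rk K - z], that of g (z-1) becomes q^(rk K - z) [z]; by [gr] the
   two terms cancel. *)
have -> : forall a b c d e x y : R, a * x + b * ((c + d * e) * y + c * (x - y))
   = (a + b * c) * x + b * d * e * y by move=> *; ring.
by rewrite gr mulNr addrN.
Qed.

Lemma sum_gamma U K (i : nat) : rk U = (rkV V - i)%N -> (i <= rkV V)%N -> (i <= rk K)%N ->
  \sum_(J | suble J K && (rk J == i)) gamma R q (rk K) i (rk (subcap U J))
    = (suble K U)%:R.
Proof.
move=> rU iV ik; have [sKU|nKU] := boolP (suble K U); first exact: sum_gamma_sub.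
move: ik; rewrite leq_eqVlt => /orP[/eqP eik|ik]; last exact: sum_gamma_nsub.
(* For i = rk K only J = K occurs, and the Kronecker delta vanishes because U cap K is smaller than
   K. *)
apply: big1 => J /andP[sJK /eqP rJ].
have -> : J = K by apply: suble_rk_eq => //; rewrite rJ eik.
rewrite /gamma eik eqxx; case: eqP => // e.
case/negP: nKU; have <- : subcap U K = K by apply: suble_rk_eq; rewrite ?suble_capr ?e.
exact: suble_capl.
Qed.
End Incidence.

(** * The chain of function spaces and independence of the generators *)

Section Functions.
Variables (R : realType) (V : qspace).
Implicit Types A B C U W H I J K L : subsp V.
Local Notation q := (qorder V).
Local Notation qn m := ((qint q m)%:R : R).
Local Notation n := (rkV V).

Lemma sum_grass (W : nmodType) (i : nat) (P : pred (subsp V)) (F : subsp V -> W) :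
  \sum_(I : grass V i | P (val I)) F (val I) = \sum_(U | P U && (rk U == i)) F U.
Proof.
under [RHS]eq_bigl do rewrite andbC.
exact: (esym (big_sub_cond (fun U => rk U == i) P F)).
Qed.

Lemma xfun_in_Vbar (k i : nat) (I : grass V i) : xfun R k (val I) \in Vbar R V k i.
Proof.
apply: memv_span; apply/tnthP; exists (enum_rank I).
by rewrite tnth_mktuple enum_rankK.
Qed.

(** If I <= K, exactly [k-t] subspaces of rank t+1 lie between them, so [k-t] x_I is the sum of the
    x_J over the J of rank t+1 above I. *)
Lemma Vbar_subS (k t : nat) : (t < k)%N -> (Vbar R V k t <= Vbar R V k t.+1)%VS.
Proof.
move=> tk; apply/span_subvP => _ /tnthP[j ->]; rewrite tnth_mktuple.
set I := enum_val j; have rI := eqP (valP I).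
have n0 : qn (k - t) != 0 by apply: qintR_neq0; lia.
have -> : xfun R k (val I) =
    (qn (k - t))^-1 *: \sum_(J : grass V t.+1 | suble (val I) (val J)) xfun R k (val J).
  apply/ffunP => K; have rK := eqP (valP K).
  rewrite !ffunE sum_ffunE (eq_bigr (fun J : grass V t.+1 => (suble (val J) (val K))%:R)) => [|J _]; last first.
    by rewrite ffunE.
  rewrite (sum_grass _ t.+1 (suble (val I)) (fun J => (suble J (val K))%:R : R)).
  have -> : \sum_(J | suble (val I) J && (rk J == t.+1)) (suble J (val K))%:R
      = \sum_(J | [&& suble (val I) J, suble J (val K) & rk J == t.+1]) 1 :> R.
    rewrite big_mkcond [RHS]big_mkcond; apply: eq_bigr => J _.
    by case: (suble (val I) J); case: (suble J _); case: (rk J == _).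
  have [sIK|nIK] := boolP (suble (val I) (val K)).
    have := card_atoms _ _ _ sIK; rewrite rI rK => cI.
    by rewrite sumr_const cI -[RHS]/(_ * _) mulVf.
  rewrite big_pred0 ?scaler0 // => J; apply/negP => /and3P[sIJ sJK _].
  by case/negP: nIK; apply: suble_trans sJK.
by apply: memvZ; apply: memv_suml => J _; apply: xfun_in_Vbar.
Qed.

Lemma Vbar_sub (k t i : nat) : (t <= i)%N -> (i <= k)%N -> (Vbar R V k t <= Vbar R V k i)%VS.
Proof.
elim: i => [|i IH]; first by rewrite leqn0 => /eqP ->; rewrite subvv.
rewrite leq_eqVlt => /orP[/eqP -> _|ti ik]; first by rewrite subvv.
by apply: subv_trans (IH _ _) (Vbar_subS _ _ ik); lia.
Qed.

Variable perp : subsp V -> subsp V.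
Hypothesis antiP : antiauto perp.

(** Summing over the hyperplanes of a subspace counts each I with the same non-zero factor, so
    vanishing climbs one rank at a time. *)
Lemma sums_zero_up (c : subsp V -> R) (i k m : nat) : (i <= k)%N ->
  (forall K, rk K = k -> \sum_(I | suble I K && (rk I == i)) c I = 0) ->
  forall K, rk K = (k + m)%N -> \sum_(I | suble I K && (rk I == i)) c I = 0.
Proof.
move=> ik c0; elim: m => [|m IH] K; first by rewrite addn0; apply: c0.
rewrite addnS => rK; have n0 : qn ((k + m).+1 - i) != 0 by apply: qintR_neq0; lia.
apply: (mulfI n0); rewrite mulr0 -(sum_flags_coatoms _ _ _ antiP _ _ _ _ rK).
by apply: big1 => J /andP[_ /eqP rJ]; apply: IH.
Qed.

(** This is the independence of the x_I in coordinates. [sums_zero_up] reduces it to k = n - i,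
    where [sum_gamma] supplies an explicit inverse. *)
Lemma sums_zero (c : subsp V -> R) (i k : nat) : (i <= k)%N -> (k <= n - i)%N ->
  (forall K, rk K = k -> \sum_(I | suble I K && (rk I == i)) c I = 0) ->
  forall I, rk I = i -> c I = 0.
Proof.
move=> ik kn c0 U rU.
have iV : (i <= n)%N by rewrite -rU rk_suble // suble_top.
have {}c0 K : rk K = (n - i)%N -> \sum_(I | suble I K && (rk I == i)) c I = 0.
  move=> rK; apply: (sums_zero_up c i k (n - i - k) ik c0); rewrite rK; lia.
(* In rank i only I = U contains U; the indicator is written through [perp] so that [sum_gamma] can
   expand it. *)
have -> : c U = \sum_(I | rk I == i) c I * (suble (perp I) (perp U))%:R.
  rewrite (bigD1 U) /=; last by rewrite rU.
  rewrite suble_refl mulr1 big1 ?addr0 // => I /andP[/eqP rI nI].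
  rewrite -antiP.2; case: (boolP (suble U I)) => [sUI|_]; last by rewrite mulr0.
  by case/eqP: nI; apply/esym/suble_rk_eq; rewrite ?rI ?rU.
rewrite (eq_bigr (fun I => \sum_(J | suble J (perp I) && (rk J == i))
    c I * gamma R q (n - i) i (rk (subcap (perp U) J)))); last first.
  move=> I /eqP rI; rewrite -big_distrr /=; congr (_ * _).
  have rpI : rk (perp I) = (n - i)%N by rewrite (rk_perp _ _ antiP) rI.
  rewrite -(sum_gamma R V perp antiP (perp U) (perp I) i) //.
  - by rewrite rpI.
  - by rewrite (rk_perp _ _ antiP) rU.
  - by rewrite rpI; lia.
(* For fixed J there remains the sum of c over the I below the preimage of J under [perp], of rank n
   - i, hence zero. *)
rewrite (exchange_big_dep (fun J => rk J == i)) /=; last by move=> I J _ /andP[].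
apply: big1 => J /eqP rJ.
have [g gK Kg] := antiP.1.
rewrite -big_distrl /= [X in X * _](_ : _ = 0) ?mul0r //.
rewrite -[RHS](c0 (g J)); last first.
  have := rk_suble _ _ _ (suble_top _ (g J)); have := rk_perp _ _ antiP (g J).
  by rewrite Kg rJ -/(rkV V); lia.
apply: eq_bigl => I; rewrite rJ eqxx andbT andbC; congr (_ && _).
by rewrite [RHS]antiP.2 Kg.
Qed.

Lemma xfuns_free (k i : nat) : (i <= k)%N -> (k <= n - i)%N -> free (xfuns R V k i).
Proof.
move=> ik kn; apply/freeP => c c0 j.
(* Extension of c by 0 to subspaces of all ranks, as [sums_zero] expects. *)
pose C U := oapp (fun I : grass V i => c (enum_rank I)) 0 (insub U).
have CE (I : grass V i) : C (val I) = c (enum_rank I) by rewrite /C valK.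
have -> : c j = C (val (enum_val j)) by rewrite CE enum_valK.
apply: (sums_zero C i k ik kn); last exact: eqP (valP (enum_val j)).
move=> K /eqP rK; rewrite -(sum_grass _ i (fun U => suble U K) C).
have /ffunP/(_ (Sub K rK : grass V k)) := c0; rewrite sum_ffunE ffunE => cK.
rewrite -[RHS]cK.
rewrite (reindex (@enum_rank (grass V i))) /=; last by apply: onW_bij; apply: enum_rank_bij.
rewrite [LHS]big_mkcond; apply: eq_bigr => I _.
rewrite CE nth_mktuple ffunE enum_rankK ffunE SubK -[RHS]/(_ * _).
by case: suble; rewrite ?mulr1 ?mulr0.
Qed.
End Functions.

(** * Weights of the dualized function *)

Theorem theorem5p8 (R : realType) (V : qspace) (perp : subsp V -> subsp V)
    (k i : nat) (f : kfun R V k) :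
  antiauto perp ->
  (k <= rkV V)%N ->
  (odflt 0 (degree f) <= i)%N ->
  (i <= minn k (rkV V - k))%N ->
  dualfun perp f \in Vbar R V (rkV V - k) i /\
  forall J : grass V i,
    wt (dualfun perp f) J =
    \sum_(I : grass V i)
      gamma R (qorder V) (rkV V - k) i (rk (subcap (perp (val I)) (val J)))
      * wt f I.
Proof.
move=> antiP kV degf; rewrite leq_min => /andP[ik inK].
have fV : f \in Vbar R V k i.
  have [->|fn0] := eqVneq f 0; first exact: mem0v.
  pose P t := f \in Vbar R V k t; pose s := iota 0 (minn k (rkV V - k)).+1.
  (* The degree is a position in [s], equal to the entry there; being at most i it lies inside [s],
     so the search succeeds. *)
  have fi : (find P s <= i)%N by move: degf; rewrite /degree (negbTE fn0).
  have hs : has P s.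
    by rewrite has_find (leq_ltn_trans fi) // size_iota ltnS leq_min ik.
  have := nth_find 0%N hs; rewrite nth_iota; last by rewrite has_find size_iota in hs.
  by apply: subvP; apply: Vbar_sub.
pose c (J : subsp V) := \sum_(I : grass V i)
      gamma R (qorder V) (rkV V - k) i (rk (subcap (perp (val I)) J)) * wt f I.
have dE : dualfun perp f = \sum_(J : grass V i) c (val J) *: xfun R (rkV V - k) (val J).
  apply/ffunP => K'; have [g gK Kg] := antiP.1.
  have rK' := eqP (valP K').
  have rK : rk (g (val K')) == k.
    have := rk_suble _ _ _ (suble_top _ (g (val K'))).
    have := rk_perp _ _ antiP (g (val K')); rewrite Kg rK' -/(rkV V); lia.
  rewrite (@dualfunE R V perp k f (Sub (g (val K')) rK) K') ?SubK ?Kg //.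
  rewrite {1}(wt_sum fV) !sum_ffunE.
  transitivity (\sum_(J | suble J (val K') && (rk J == i)) c J); last first.
    rewrite -(sum_grass _ _ i (fun J => suble J (val K')) c) big_mkcond.
    apply: eq_bigr => J _; rewrite !ffunE -[RHS]/(_ * _).
    by case: suble; rewrite ?mulr1 ?mulr0.
  (* For each I the sum over J is the [gamma] identity with U = perp I. It gives [K' <= perp I] =
     [I <= g K'], the value of x_I at the preimage of K'. *)
  rewrite exchange_big /=; apply: eq_bigr => I _.
  have rI := eqP (valP I).
  have := sum_gamma R V perp antiP (perp (val I)) (val K') i.
  rewrite (rk_perp _ _ antiP) rI rK' => sumE.
  rewrite -big_distrl /= sumE //; last lia.
  by rewrite !ffunE antiP.2 SubK Kg -[LHS]/(_ * _) mulrC.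
split.
  by rewrite dE; apply: memv_suml => J _; apply: memvZ; apply: xfun_in_Vbar.
(* [wt] is a coordinate, so reading off c J needs freeness at rank n - k; the bounds i <= n - k <= n
   - i come from i <= min(k, n - k). *)
move=> J; rewrite dE /wt.
rewrite (eq_bigr (fun J : grass V i => c (val J) *: (xfuns R V (rkV V - k) i)`_(enum_rank J))); last first.
  by move=> I _; rewrite nth_mktuple enum_rankK.
rewrite (reindex (fun j : 'I_#|{: grass V i}| => enum_val j)) /=; last by apply: onW_bij; apply: enum_val_bij.
under eq_bigr do rewrite enum_valK.
rewrite (coord_sum_free (fun j => c (val (enum_val j)))) ?enum_rankK //.
by apply: (xfuns_free _ _ _ antiP); lia.
Qed.
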